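(* Let $e>1$ be the real number defined by the equation $\int_{1}^{e}\frac{1}{x}\,dx=1$. Then $2.7<e<2.75$. *)

(* Defs.v *)
From Stdlib Require Import Reals Lra.
From Coquelicot Require Import Coquelicot.
Open Scope R_scope.

(** The number e is well defined, so a statement about every [e > 1] with
    [is_RInt (fun x => 1 / x) 1 e 1] is a statement about exactly one number. *)
Lemma e_well_defined :
  exists! e : R, 1 < e /\ is_RInt (fun x => 1 / x) 1 e 1.
Proof.
assert (H : forall b, 1 < b -> is_RInt (fun x => 1 / x) 1 b (ln b)).
{ intros b Hb.
  replace (ln b) with (minus (ln b) (ln 1))
    by (rewrite ln_1; unfold minus, plus, opp; simpl; ring).
  apply (is_RInt_derive ln).
  - intros x [Hx _]. rewrite Rmin_left in Hx by lra.
    replace (1 / x) with (/ x) by (field; lra).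
    apply is_derive_Reals, derivable_pt_lim_ln. lra.
  - intros x [Hx _]. rewrite Rmin_left in Hx by lra.
    apply (ex_derive_continuous (fun x => 1 / x)). auto_derive. lra. }
assert (He : 1 < exp 1).
{ rewrite <- exp_0 at 1. apply exp_increasing. lra. }
exists (exp 1). split.
- split; [exact He|]. rewrite <- (ln_exp 1) at 3. now apply H.
- intros b [Hb Hi].
  apply ln_inv; [lra|lra|]. rewrite ln_exp.
  rewrite <- (is_RInt_unique _ _ _ _ Hi). apply is_RInt_unique. now apply H.
Qed.

(* Main.v *)
(** The hypothesis says [ln e = 1], so [e = exp (1/100) ^ 100] and
    [/ e = exp (-1/100) ^ 100].  Since [1 + x < exp x] for [x <> 0], this gives
    [1.01 ^ 100 < e] and [0.99 ^ 100 < / e], and the rest is arithmetic. *)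
Require Import Defs.
From Stdlib Require Import Reals Lra.
From Coquelicot Require Import Coquelicot.
Open Scope R_scope.

Lemma is_RInt_inv_ln (b : R) (hb : 1 < b) :
  is_RInt (fun x : R => 1 / x) 1 b (ln b).
Proof.
replace (ln b) with (minus (ln b) (ln 1))
  by (rewrite ln_1; unfold minus, plus, opp; simpl; ring).
apply (is_RInt_derive ln); intros x [Hx _]; rewrite Rmin_left in Hx by lra.
- auto_derive; [lra | field; lra].
- apply (ex_derive_continuous (fun x => 1 / x)). auto_derive. lra.
Qed.

Lemma exp_INR_mult (n : nat) (x : R) : exp (INR n * x) = exp x ^ n.
Proof.
induction n as [|n IH].
- simpl. now rewrite Rmult_0_l, exp_0.
- rewrite S_INR, Rmult_plus_distr_r, Rmult_1_l, exp_plus, IH. simpl. ring.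
Qed.

(** Both sides of [1 + x < exp x] are raised to the power [n]: [0 <= 1 + x] makes this monotone,
    while [x <> 0] and [0 < n] keep it strict. *)
Lemma pow_one_plus_lt_exp (n : nat) (x : R) :
  (0 < n)%nat -> x <> 0 -> 0 <= 1 + x -> (1 + x) ^ n < exp (INR n * x).
Proof.
intros Hn Hx H1. rewrite exp_INR_mult.
pose proof (exp_ineq1 x Hx) as H.
destruct n as [|n]; [inversion Hn|]. clear Hn.
(* The exponent is now [S n], so the induction starts at power 1; at power 0 both sides equal 1. *)
induction n as [|n IH].
- now rewrite !pow_1.
- rewrite <- (tech_pow_Rmult (1 + x)), <- (tech_pow_Rmult (exp x)).
  apply Rmult_le_0_lt_compat; try assumption. now apply pow_le.
Qed.

Theorem mainTheorem3 (e : R) (he1 : 1 < e)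
  (he : is_RInt (fun x : R => 1 / x) 1 e 1) :
  2.7 < e < 2.75.
Proof.
assert (Hln : ln e = 1).
{ rewrite <- (is_RInt_unique _ _ _ _ he). symmetry.
  now apply is_RInt_unique, is_RInt_inv_ln. }
assert (He : e = exp 1) by (rewrite <- Hln, exp_ln; lra).
assert (HN : INR 100 = 100) by (rewrite INR_IZR_INZ; reflexivity).
assert (Hlo : (1 + 1 / 100) ^ 100 < e).
{ rewrite He. replace 1 with (INR 100 * (1 / 100)) at 3 by (rewrite HN; field).
  apply pow_one_plus_lt_exp; [apply Nat.lt_0_succ | lra | lra]. }
assert (Hup : (1 + - (1 / 100)) ^ 100 < / e).
{ rewrite He, <- exp_Ropp.
  replace (- (1)) with (INR 100 * - (1 / 100)) by (rewrite HN; field).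
  apply pow_one_plus_lt_exp; [apply Nat.lt_0_succ | lra | lra]. }
split.
(* 1.01^100 is about 2.7048. This is the tighter side: 1.02^50 is only about 2.692. *)
- apply Rlt_trans with (2 := Hlo). lra.
(* Reciprocals are compared: 1/2.75 is about 0.3636 and 0.99^100 about 0.3660. *)
- apply Rinv_lt_cancel; [lra|].
  apply Rlt_trans with (2 := Hup). lra.
Qed.
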